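(* For every instance of the ATP problem with identical request distributions $\mathcal D_1=\dots=\mathcal D_T=\mathcal D$ of finite support and with $B_0=B=1$, there exists an online algorithm whose expected profit is at least $\tfrac14$ times the expected profit of the optimal offline algorithm.
   Context: ATP (Asymmetric Trading Prophets) problem. A decision maker interacts with $T$ sequentially arriving requests to trade copies of a product. She has capacity $B\ge 1$ (she may hold at most $B$ copies at any time) and starts with an initial inventory of $B_0\in\{0,\dots,B\}$ copies. It is assumed throughout that $T\ge B_0$ and $B\le B_0+T$. At time $t\in\{1,\dots,T\}$ a price tuple $(b_t,s_t)$ is revealed, with $b_t\in[0,+\infty]$ (the cost of buying a copy; $b_t=+\infty$ means buying is impossible) and $s_t\in[0,\infty)$ (the revenue from selling a copy); $(b_t,s_t)$ is drawn from a known distribution $\mathcal D_t$, independently across $t$, while $b_t$ and $s_t$ may be arbitrarily correlated with each other. At time $t$ she takes exactly one action: Buy one copy at price $b_t$ (allowed if she holds at most $B-1$ copies), Sell one copy at price $s_t$ (allowed if she holds at least one copy), or Skip. Profit is total revenue from sales minus total cost of purchases. An online algorithm (possibly randomized) chooses its action at time $t$ knowing only the distributions, the tuples revealed up to and including time $t$, and its past actions. The optimal offline algorithm knows all realized tuples in advance and attains the maximum possible profit for each realization; its expected profit is the expectation of this maximum. *)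

(* Defs.v *)
From HB Require Import structures.
From mathcomp Require Import all_boot all_order all_algebra finmap.
From mathcomp Require Import reals constructive_ereal.

Set Implicit Arguments.
Unset Strict Implicit.
Unset Printing Implicit Defensive.

Import Order.TTheory GRing.Theory Num.Theory.
Local Open Scope ring_scope.
Local Open Scope fset_scope.

Inductive action := Buy | Sell | Skip.

Definition action_code (a : action) : 'I_3 :=
  match a with Buy => inord 0 | Sell => inord 1 | Skip => inord 2 end.

Definition action_decode (i : 'I_3) : action :=
  match val i with 0%N => Buy | 1%N => Sell | _ => Skip end.

Lemma action_codeK : cancel action_code action_decode.
Proof. by case; rewrite /action_decode /= inordK. Qed.

HB.instance Definition _ := Equality.copy action (can_type action_codeK).
HB.instance Definition _ := Choice.copy action (can_type action_codeK).
HB.instance Definition _ := Countable.copy action (can_type action_codeK).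
HB.instance Definition _ := Finite.copy action (can_type action_codeK).

(* A price tuple (b, s): b is the buying cost (+oo when buying is impossible),
   s the selling revenue. *)
Notation price R := (\bar R * R)%type.

Record price_dist (R : realType) := PriceDist {
  pmf :> {fsfun price R -> R with 0};
  pmf_ge0 : forall x, 0 <= pmf x;
  pmf_sum1 : \sum_(x <- finsupp pmf) pmf x = 1;
  pmf_supp : forall x, x \in finsupp pmf -> (0%E <= x.1)%E /\ 0 <= x.2 }.

Record atp (R : realType) := ATP {
  horizon : nat;
  capacity : nat;
  init_stock : nat;
  dist : 'I_horizon -> price_dist R;
  capacity_ge1 : (1 <= capacity)%N;
  init_le_capacity : (init_stock <= capacity)%N;
  init_le_horizon : (init_stock <= horizon)%N;
  capacity_le : (capacity <= init_stock + horizon)%N }.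

Section Atp.
Variable R : realType.
Implicit Types (I : atp R) (p : price R) (a : action).

Definition gain p a : R :=
  match a with Buy => - fine p.1 | Sell => p.2 | Skip => 0 end.

(* [fine +oo = 0], so [gain] is meaningful only for allowed actions: buying at
   price +oo is excluded here. *)
Definition allowed (B stock : nat) p a : bool :=
  match a with
  | Buy => (stock < B)%N && (p.1 != +oo%E)
  | Sell => (0 < stock)%N
  | Skip => true
  end.

Definition update_stock (stock : nat) a : nat :=
  match a with Buy => stock.+1 | Sell => stock.-1 | Skip => stock end.

(* Revealed price tuples and actions taken, in chronological order. *)
Definition history := seq (price R * action).

Definition stock_after I (h : history) : nat :=
  foldl update_stock (init_stock I) [seq pa.2 | pa <- h].

Definition history_before I (w : 'I_(horizon I) -> price R)
    (x : {ffun 'I_(horizon I) -> action}) (t : 'I_(horizon I)) : history :=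
  [seq (w u, x u) | u : 'I_(horizon I) <- enum 'I_(horizon I) & (u < t)%N].

Definition feasible I (w : 'I_(horizon I) -> price R)
    (x : {ffun 'I_(horizon I) -> action}) : bool :=
  [forall t, allowed (capacity I) (stock_after I (history_before w x t))
               (w t) (x t)].

Definition profit I (w : 'I_(horizon I) -> price R)
    (x : {ffun 'I_(horizon I) -> action}) : R :=
  \sum_t gain (w t) (x t).

(* Expectation over independent price tuples w t ~ dist I t. *)
Definition price_expectation I (F : ('I_(horizon I) -> price R) -> R) : R :=
  \sum_(w : {dffun forall t : 'I_(horizon I), finsupp (dist t)})
    (\prod_t dist t (val (w t))) * F (fun t => val (w t)).

(* The default value 0 of the maximum is the profit of the feasible sequence
   that always skips. *)
Definition offline_profit I (w : 'I_(horizon I) -> price R) : R :=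
  \big[Num.max/0]_(x : {ffun 'I_(horizon I) -> action} | feasible w x)
    profit w x.

Definition expected_offline_profit I : R :=
  price_expectation (@offline_profit I).

(* [choose h p a] is the probability of taking action [a] when the current
   price tuple is [p] and the past is [h]; the current time is [size h]. *)
Record online_algorithm I := OnlineAlgorithm {
  choose :> history -> price R -> action -> R;
  choose_ge0 : forall h p a, 0 <= choose h p a;
  choose_sum1 : forall h p, \sum_a choose h p a = 1;
  choose_allowed : forall h p a,
    0 < choose h p a -> allowed (capacity I) (stock_after I h) p a }.

Definition action_probability I (A : online_algorithm I)
    (w : 'I_(horizon I) -> price R) (x : {ffun 'I_(horizon I) -> action}) : R :=
  \prod_t A (history_before w x t) (w t) (x t).

Definition expected_online_profit I (A : online_algorithm I) : R :=
  price_expectation (fun w => \sum_(x : {ffun 'I_(horizon I) -> action})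
    action_probability A w x * profit w x).

End Atp.

(* Main.v *)
(** Value a unit of stock at [lam >= 0].  As sales exceed purchases by at most
    one, the offline profit is at most [lam] plus the sum over time of
    [max (s - lam, lam - b, 0)].  By a quantile argument, [lam] and a
    randomization of ties can be chosen so that the maximizing actions "sell"
    and "buy" have probabilities [al] and [be] with [al = be + 1/n]; let [u] and
    [v] be their expected contributions to the maximum, so that the optimum is
    at most [n (u + v) + lam].  Online, take the maximizing action whenever the
    stock permits it.  If [r t] is the probability of being empty after [t]
    steps, the expected profit is [u * sum (1 - r t) + v * sum (r t) + lam * r n].
    Since [r] is nondecreasing and concave in [t], the flow identity
    [al * sum (1 - r t) - be * sum (r t) = r n] gives [sum (1 - r t) >= n/2],
    [r n >= 1/2] and, for [n >= 2], [sum (r t) >= n/4]; for [n = 1], [v = 0]. *)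
Require Import Defs.
From HB Require Import structures.
From mathcomp Require Import all_boot all_order all_algebra finmap.
From mathcomp Require Import reals constructive_ereal lra ring.
From mathcomp Require boolp.

Set Implicit Arguments.
Unset Strict Implicit.
Unset Printing Implicit Defensive.

Import Order.TTheory GRing.Theory Num.Theory.
Local Open Scope ring_scope.

Lemma sum_action (V : zmodType) (F : action -> V) :
  \sum_a F a = F Buy + F Sell + F Skip.
Proof.
rewrite (bigD1 Buy) // (bigD1 Sell) /=; last by apply/eqP.
rewrite (bigD1 Skip) /=; last by apply/andP; split; apply/eqP.
by rewrite big_pred0 ?addr0 ?addrA //; case; rewrite ?eqxx ?andbF.
Qed.

Lemma sum_pair_action (V : zmodType) (Z : finType) (F : Z * action -> V) :
  \sum_j F j = \sum_z (F (z, Buy) + F (z, Sell) + F (z, Skip)).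
Proof.
rewrite (eq_bigr (fun j => F (j.1, j.2))) => [|[]//].
rewrite -(pair_bigA _ (fun z a => F (z, a))) /=.
by apply: eq_bigr => z _; rewrite sum_action.
Qed.

(** * Randomized quantiles of a finite weighted family *)

Section Tail.
Variable R : realFieldType.
Implicit Types lam th c : R.

(** The probability that [c] counts as lying above [lam] when a tie counts with probability [th]. *)
Definition tail_indicator lam th c : R :=
  if lam < c then 1 else if lam == c then th else 0.

Lemma tail_indicator_bounds lam th c : 0 <= th <= 1 ->
  0 <= tail_indicator lam th c <= 1.
Proof. by rewrite /tail_indicator; case: ltgtP => // *; rewrite ?lexx ?ler01. Qed.

Lemma le_tail_indicator lam th c c' : 0 <= th <= 1 -> c <= c' ->
  tail_indicator lam th c <= tail_indicator lam th c'.
Proof. by move=> th01; rewrite /tail_indicator; do 2 case: ltgtP => // *; lra. Qed.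

(** Take [lam] as the largest candidate level whose closed tail still has mass at least [q]. Its
    open tail then has mass at most [q], and [th] supplies the missing share of the atom at
    [lam]. *)
Lemma randomized_quantile (J : finType) (m c : J -> R) (q : R) :
    (forall j, 0 <= m j) -> (forall j, 0 <= c j) -> 0 <= q <= \sum_j m j ->
  exists lam th, [/\ 0 <= lam, 0 <= th <= 1
    & \sum_j m j * tail_indicator lam th (c j) = q].
Proof.
move=> m0 c0 /andP[q0 qm].
(* [None] adds the level 0, whose tail is the whole mass; this makes a candidate available and keeps
   [lam] nonnegative. *)
pose key (o : option J) := if o is Some j then c j else 0.
pose G z := \sum_(j | z <= c j) m j.
have G0 : q <= G (key None).
  by rewrite /G /= (eq_bigl xpredT) // => j; rewrite c0.
have [o Go omax] := @arg_maxP _ R _ None (fun o => q <= G (key o)) key G0.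
set lam := key o in Go omax.
have lam0 : 0 <= lam by rewrite /lam; case: o {Go omax lam} => //=.
have ltq : \sum_(j | lam < c j) m j <= q.
  rewrite leNgt; apply/negP => qlt.
  have [j0 lamj0|none] := pickP (fun j => lam < c j); last first.
    by move: qlt; rewrite big_pred0 // ltNge q0.
  (* The closed tail at the least value above [lam] is the open tail at [lam], so a mass above [q]
     would contradict maximality. *)
  have [j lamj jmin] := @arg_minP _ R _ j0 (fun j => lam < c j) c lamj0.
  have /omax : q <= G (key (Some j)).
    apply: (le_trans (ltW qlt)); rewrite le_eqVlt; apply/orP; left; apply/eqP.
    apply: eq_bigl => i /=; apply/idP/idP => [|/(lt_le_trans lamj)//].
    exact: jmin.
  by rewrite /= leNgt lamj.
have GE : G lam = \sum_(j | lam < c j) m j + \sum_(j | lam == c j) m j.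
  rewrite /G [LHS]big_mkcond [X in _ = X + _]big_mkcond [X in _ = _ + X]big_mkcond.
  rewrite -big_split; apply: eq_bigr => j _ /=.
  by case: ltgtP => _; rewrite ?addr0 ?add0r.
have splitE th : \sum_j m j * tail_indicator lam th (c j)
    = \sum_(j | lam < c j) m j + th * \sum_(j | lam == c j) m j.
  rewrite mulr_sumr [X in _ = X + _]big_mkcond [X in _ = _ + X]big_mkcond.
  rewrite -big_split; apply: eq_bigr => j _ /=.
  by rewrite /tail_indicator; case: ltgtP => _; rewrite ?addr0 ?add0r ?mulr1 ?mulr0 // mulrC.
rewrite GE in Go.
set A := \sum_(j | lam < c j) m j in ltq GE splitE Go.
set E := \sum_(j | lam == c j) m j in GE splitE Go.
have E0 : 0 <= E by apply: sumr_ge0.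
have [E1|E1] := eqVneq E 0.
  by exists lam, 0; split; rewrite ?lexx ?ler01 // splitE; lra.
exists lam, ((q - A) / E); split => //.
  have Ep : 0 < E by rewrite lt_neqAle eq_sym E1.
  by rewrite divr_ge0 ?subr_ge0 //= ler_pdivrMr // mul1r; lra.
by rewrite splitE divfK //; ring.
Qed.

End Tail.

(** * Weighted sums over words, one symbol at a time *)

Section Trajectories.
Variables (R : comNzRingType) (Z : finType) (K : seq Z -> Z -> R).

(* Sum of [F] over the extensions of [h] by [n] symbols, weighted by the
   product of the [K] of each new symbol given the word before it. *)
Fixpoint run_sum (F : seq Z -> R) (n : nat) (h : seq Z) : R :=
  if n is n'.+1 then \sum_z K h z * run_sum F n' (rcons h z) else F h.

Lemma eq_run_sum F F' n h : F =1 F' -> run_sum F n h = run_sum F' n h.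
Proof. by move=> FF'; elim: n h => //= n IH h; under eq_bigr do rewrite IH. Qed.

Definition ffun_cons n (z : Z) (f : {ffun 'I_n -> Z}) : {ffun 'I_n.+1 -> Z} :=
  [ffun i => oapp f z (unlift ord0 i)].

(** The induction splits off the first symbol of [f] and appends it to [h]; hence the general
    prefix. *)
Lemma run_sum_ffun_from (F : seq Z -> R) n (h : seq Z) :
  \sum_(f : {ffun 'I_n -> Z})
     (\prod_(t < _) K (h ++ take t [seq f i | i <- enum 'I_n]) (f t)) *
     F (h ++ [seq f i | i <- enum 'I_n])
  = run_sum F n h.
Proof.
elim: n h => [|n IHn] h /=.
  rewrite (big_pred1 [ffun i : 'I_0 => False_rect Z (notF (ltn_ord i))]).
    by rewrite big_ord0 mul1r enum_ord0 /= cats0.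
  by move=> f; symmetry; apply/eqP/ffunP => -[].
rewrite (reindex (fun zf : Z * {ffun 'I_n -> Z} => ffun_cons zf.1 zf.2)) /=; last first.
  exists (fun f => (f ord0, [ffun i => f (lift ord0 i)])) => [[z f]|f] _ /=.
    by congr pair; [rewrite ffunE unlift_none | apply/ffunP => i; rewrite !ffunE liftK].
  by apply/ffunP => i; rewrite !ffunE; case: unliftP => [j|] -> //=; rewrite ffunE.
rewrite -(pair_bigA _ (fun z f => (\prod_(t < _) K (h ++ take t [seq ffun_cons z f i | i <- enum 'I_n.+1])
  (ffun_cons z f t)) * F (h ++ [seq ffun_cons z f i | i <- enum 'I_n.+1]))) /=.
apply: eq_bigr => z _; rewrite -IHn mulr_sumr; apply: eq_bigr => f _.
have -> : [seq ffun_cons z f i | i <- enum 'I_n.+1] = z :: [seq f i | i <- enum 'I_n].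
  rewrite enum_ordSl /= -map_comp ffunE unlift_none /=; congr cons.
  by apply: eq_map => i; rewrite /= ffunE liftK.
rewrite cat_rcons big_ord_recl /= ?take0 cats0 ffunE unlift_none /= mulrA.
congr (_ * _ * _); apply: eq_bigr => i _.
by rewrite ffunE liftK /= cat_rcons.
Qed.

Lemma run_sum_ffun (F : seq Z -> R) n :
  \sum_(f : {ffun 'I_n -> Z})
     (\prod_(t < _) K (take t [seq f i | i <- enum 'I_n]) (f t)) *
     F [seq f i | i <- enum 'I_n]
  = run_sum F n [::].
Proof. exact: (run_sum_ffun_from F n [::]). Qed.

End Trajectories.

(** * The two-state stock chain *)

Section Chain.
Variables (R : realFieldType) (al be : R).

(* Probability that the stock is empty after [t] steps, starting full, when a
   full stock is sold with probability [al] and an empty one refilled with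
   probability [be] at each step. *)
Fixpoint empty_prob (t : nat) : R :=
  if t is t'.+1 then al + (1 - al - be) * empty_prob t' else 0.

Hypotheses (al0 : 0 <= al) (be0 : 0 <= be) (albe : al + be <= 1).

Let stay_ge0 : 0 <= 1 - al - be.
Proof. by have := albe; lra. Qed.

Lemma empty_probS t : empty_prob t.+1 = empty_prob t + al * (1 - al - be) ^+ t.
Proof.
elim: t => [|t IH]; first by rewrite /= expr0; ring.
by rewrite [LHS]/= -/(empty_prob t.+1) {1}IH /= exprS; ring.
Qed.

Lemma empty_prob_homo : {homo empty_prob : m n / (m <= n)%N >-> m <= n}.
Proof.
apply: homo_leq => [|? ? ?|t]; [exact: lexx | exact: le_trans |].
by rewrite empty_probS lerDl mulr_ge0 // exprn_ge0.
Qed.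

(** The value at [t] is a sum of [t] geometric increments, each at least as large as the next one,
    [al * (1 - al - be) ^+ t]. *)
Lemma empty_prob_concave t : t%:R * (al * (1 - al - be) ^+ t) <= empty_prob t.
Proof.
elim: t => [|t IH]; first by rewrite mul0r.
rewrite empty_probS -natr1 exprS.
set k := al * (1 - al - be) ^+ t in IH *.
have k0 : 0 <= k by rewrite mulr_ge0 // exprn_ge0.
rewrite [al * _]mulrCA -/k.
apply: (@le_trans _ _ ((t%:R + 1) * k)); last by lra.
by rewrite ler_wpM2l ?addr_ge0 // ler_piMl //; have := al0; have := be0; lra.
Qed.

Lemma empty_prob_slope t n : (t <= n)%N ->
  t%:R * empty_prob n <= n%:R * empty_prob t.
Proof.
elim: n => [|n IH]; first by rewrite leqn0 => /eqP ->.
rewrite leq_eqVlt => /predU1P[->//|]; rewrite ltnS => tn.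
have [->|t0] := posnP t; first by rewrite mul0r mulr0.
have n0 : 0 < n%:R :> R by rewrite ltr0n (leq_trans t0).
rewrite -(ler_pM2l n0).
have h1 : n%:R * empty_prob n.+1 <= n.+1%:R * empty_prob n.
  by rewrite empty_probS -natr1; have := empty_prob_concave n; lra.
have h2 := IH tn.
rewrite mulrCA; apply: (le_trans (ler_wpM2l (ler0n _ _) h1)).
by rewrite mulrCA [leRHS]mulrCA ler_wpM2l.
Qed.

Lemma empty_prob_flow n :
  al * (n%:R - \sum_(t < n) empty_prob t) - be * \sum_(t < n) empty_prob t
  = empty_prob n.
Proof.
elim: n => [|n IH]; first by rewrite big_ord0 /=; ring.
by rewrite big_ord_recr /= -natr1; lra.
Qed.

(** Let [Q] be the sum and [r] the last probability. Monotonicity gives [Q <= n r], and the flow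
    identity times [n] reads [n r = (n - Q) + n be (n - 2 Q)]. If [Q > n / 2], the right side would
    be below [n / 2], hence below [Q]. *)
Lemma sum_empty_prob_ub n : (0 < n)%N -> al = be + n%:R^-1 ->
  \sum_(t < n) empty_prob t <= n%:R / 2 /\ 2^-1 <= empty_prob n.
Proof.
move=> n0 alE; have := empty_prob_flow n; set Q := \sum_(t < n) _ => flow.
have np : 0 < n%:R :> R by rewrite ltr0n.
have Qn : Q <= n%:R * empty_prob n.
  have -> : n%:R * empty_prob n = \sum_(t < n) empty_prob n.
    by rewrite sumr_const card_ord mulr_natl.
  by apply: ler_sum => t _; apply: empty_prob_homo; rewrite ltnW.
have flow' : n%:R * empty_prob n = (n%:R - Q) + n%:R * be * (n%:R - 2 * Q).
  by rewrite -flow alE; field; rewrite gt_eqF.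
have nb : 0 <= n%:R * be by rewrite mulr_ge0 ?ler0n.
have Q2 : Q <= n%:R / 2 by nra.
split=> //; rewrite -(ler_pM2l np).
have : 0 <= n%:R * be * (n%:R - 2 * Q) by rewrite mulr_ge0 //; lra.
lra.
Qed.

(** Concavity puts the probabilities above the chord from 0 to [r], so [2 Q >= (n - 1) r]. With
    [n r >= n - Q] this yields [Q >= n (n - 1) / (3 n - 1)], which is at least [n / 4] once
    [n >= 3]. *)
Lemma sum_empty_prob_lb n : (1 < n)%N -> al = be + n%:R^-1 ->
  n%:R / 4 <= \sum_(t < n) empty_prob t.
Proof.
move=> n1 alE; have n0 : (0 < n)%N by apply: ltnW.
have np : 0 < n%:R :> R by rewrite ltr0n.
have [Qub _] := sum_empty_prob_ub n0 alE.
(* For [n = 2] the chord bound gives only [2 / 5], but the sum is exactly [al = be + 1 / 2]. *)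
move: n1; rewrite leq_eqVlt => /predU1P[n2|n3].
  by move: be0; rewrite -n2 !big_ord_recl big_ord0 /= alE -n2; lra.
have := empty_prob_flow n; move: Qub; set Q := \sum_(t < n) _ => Qub flow.
have flow' : n%:R * empty_prob n = (n%:R - Q) + n%:R * be * (n%:R - 2 * Q).
  by rewrite -flow alE; field; rewrite gt_eqF.
have gauss : 2 * \sum_(t < n) t%:R = n%:R * (n%:R - 1) :> R.
  elim: (n) => [|k IH]; first by rewrite big_ord0; ring.
  by rewrite big_ord_recr /= mulrDr IH -natr1; ring.
have Qlb : (\sum_(t < n) t%:R) * empty_prob n <= n%:R * Q.
  rewrite mulr_suml mulr_sumr; apply: ler_sum => t _.
  by rewrite empty_prob_slope // ltnW.
have n3R : 3 <= n%:R :> R by rewrite ler_nat.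
have nb : 0 <= n%:R * be by rewrite mulr_ge0 ?ler0n.
have f2 : n%:R - Q <= n%:R * empty_prob n by nra.
have f3 : (n%:R - 1) * (n%:R * empty_prob n) <= 2 * (n%:R * Q) by nra.
have f4 : (n%:R - 1) * (n%:R - Q) <= 2 * (n%:R * Q) by nra.
nra.
Qed.

End Chain.

(** * The threshold policy and its balance *)

Section Policy.
Variable R : realType.
Implicit Types (p : price R) (D : price_dist R) (lam th : R) (f g : price R -> R).

Definition mean D f : R := \sum_(z : finsupp D) D (val z) * f (val z).

Lemma mean1 D : mean D (fun=> 1) = 1.
Proof.
rewrite -[RHS](pmf_sum1 D) big_seq_fsetE /=.
by apply: eq_bigr => z _; rewrite mulr1.
Qed.

Lemma meanD D f g : mean D (fun p => f p + g p) = mean D f + mean D g.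
Proof. by rewrite -big_split; apply: eq_bigr => z _; rewrite /= mulrDr. Qed.

Lemma meanZ D c f : mean D (fun p => c * f p) = c * mean D f.
Proof. by rewrite mulr_sumr; apply: eq_bigr => z _; rewrite mulrCA. Qed.

Lemma mean_ge0 D f : (forall p, p \in finsupp D -> 0 <= f p) -> 0 <= mean D f.
Proof. by move=> f0; apply: sumr_ge0 => z _; rewrite mulr_ge0 ?pmf_ge0 ?f0 ?fsvalP. Qed.

Lemma mean_le D f g : (forall p, p \in finsupp D -> f p <= g p) ->
  mean D f <= mean D g.
Proof. by move=> fg; apply: ler_sum => z _; rewrite ler_wpM2l ?pmf_ge0 ?fg ?fsvalP. Qed.

(* Gain of an action when each unit of stock is valued [lam]. *)
Definition margin lam p a : R :=
  match a with Buy => lam - fine p.1 | Sell => p.2 - lam | Skip => 0 end.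

(* For unit values up to [sell_cap p], selling maximizes [margin _ p]; from
   [buy_floor p] on, buying does. *)
Definition sell_cap p : R :=
  if (p.2%:E <= p.1)%E then p.2 else (p.2 + fine p.1) / 2.
Definition buy_floor p : R :=
  if (p.2%:E <= p.1)%E then fine p.1 else (p.2 + fine p.1) / 2.

(** A tie is sold with probability [th] and bought with probability [1 - th], so the two
    probabilities sum to at most 1 even when [sell_cap] and [buy_floor] coincide. *)
Definition sell_prob lam th p : R := tail_indicator lam th (sell_cap p).
Definition buy_prob lam th p : R :=
  if p.1 == +oo%E then 0 else 1 - tail_indicator lam th (buy_floor p).

Lemma sell_buy_prob_bounds lam th p : 0 <= th <= 1 ->
  [/\ 0 <= sell_prob lam th p, 0 <= buy_prob lam th p
    & sell_prob lam th p + buy_prob lam th p <= 1].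
Proof.
move=> th01; have /andP[x0 x1] := tail_indicator_bounds lam (sell_cap p) th01.
rewrite /sell_prob /buy_prob; case: eqP => poo; first by split; lra.
have /andP[y0 y1] := tail_indicator_bounds lam (buy_floor p) th01.
suff /(le_tail_indicator lam th01) : sell_cap p <= buy_floor p by split; lra.
rewrite /sell_cap /buy_floor; case: ifP => //.
by case: p poo {x0 x1 y0 y1} => -[b||] s //=; rewrite lee_fin.
Qed.

(** Positive probability is given only to actions of maximal margin, so the mixture attains the
    maximum. *)
Lemma margin_le_policy lam th p : 0 <= th <= 1 -> (0 <= p.1)%E ->
  [/\ 0 <= sell_prob lam th p * margin lam p Sell,
      0 <= buy_prob lam th p * margin lam p Buy
    & forall a, (a = Buy -> p.1 != +oo%E) ->
        margin lam p a <= sell_prob lam th p * margin lam p Sell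
                        + buy_prob lam th p * margin lam p Buy].
Proof.
case: p => -[b||] s //= /andP[th0 th1] _; last first.
  rewrite /sell_prob /buy_prob /sell_cap leey eqxx /tail_indicator /=.
  split=> [|| a ainf]; [| by rewrite mul0r |].
    by case: (ltgtP lam s) => [?|?|->]; lra.
  case: a ainf => [/(_ erefl)//|_|_] /=; case: (ltgtP lam s) => [?|?|->]; lra.
rewrite /sell_prob /buy_prob /sell_cap /buy_floor /= lee_fin /tail_indicator.
case: (leP s b) => sb.
  by split => [||[] _ /=]; case: (ltgtP lam s) => [?|?|?]; case: (ltgtP lam b) => [?|?|?]; subst; lra.
(* At the tie both margins equal [(s - b) / 2]; these products are the nonlinear facts needed. *)
have thsb : 0 <= th * (s - b) by rewrite mulr_ge0 // subr_ge0 ltW.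
have thsb' : 0 <= (1 - th) * (s - b) by rewrite mulr_ge0 ?subr_ge0 // ltW.
by split => [||[] _ /=]; case: (ltgtP lam ((s + b) / 2)) => [?|?|->]; lra.
Qed.

(** Buying is the complement of a tail among finite prices. The balance therefore asks that the
    tails of [sell_cap] and of [buy_floor] together have mass [1 / n] plus the probability of a
    finite price: one quantile of the doubled family. *)
Lemma balanced_policy D n : (0 < n)%N -> exists lam th,
  [/\ 0 <= lam, 0 <= th <= 1
    & mean D (sell_prob lam th) = mean D (buy_prob lam th) + n%:R^-1].
Proof.
move=> n0; pose fin p : R := if p.1 == +oo%E then 0 else 1.
pose m (j : finsupp D * bool) := D (val j.1) * (if j.2 then fin (val j.1) else 1).
pose c (j : finsupp D * bool) := (if j.2 then buy_floor else sell_cap) (val j.1).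
have ninv : 0 <= (n%:R^-1 : R) <= 1.
  by rewrite invr_ge0 ler0n invf_le1 ?ltr0n // ler1n n0.
have fin01 p : 0 <= fin p <= 1 by rewrite /fin; case: ifP; rewrite ?lexx ?ler01.
have pairE (F : finsupp D * bool -> R) :
    \sum_j F j = \sum_z F (z, false) + \sum_z F (z, true).
  rewrite (eq_bigr (fun j => F (j.1, j.2))) => [|[]//].
  rewrite -(pair_bigA _ (fun z b => F (z, b))) -big_split /=.
  by apply: eq_bigr => z _; rewrite big_bool addrC.
have [||| lam [th [lam0 th01 qE]]] :=
    @randomized_quantile R _ m c (n%:R^-1 + mean D fin).
- move=> [z b]; rewrite mulr_ge0 ?pmf_ge0 //=; case: b => //.
  by case/andP: (fin01 (val z)).
- move=> [z b]; rewrite /c /sell_cap /buy_floor /=.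
  have [z1 z2] := pmf_supp (valP z).
  have := fine_ge0 z1; case: b; case: ifP => // *; lra.
- have m0 : 0 <= mean D fin by apply: mean_ge0 => p _; case/andP: (fin01 p).
  rewrite pairE -/(mean D (fun=> 1)) -/(mean D fin) mean1; lra.
exists lam, th; split=> //; move: qE; rewrite pairE /=.
have -> : \sum_z m (z, false) * tail_indicator lam th (c (z, false))
    = mean D (sell_prob lam th).
  by apply: eq_bigr => z _; rewrite /m /= mulr1.
suff -> : \sum_z m (z, true) * tail_indicator lam th (c (z, true))
    = mean D fin - mean D (buy_prob lam th) by lra.
rewrite -sumrB; apply: eq_bigr => z _; rewrite /m /c /fin /buy_prob /=.
by case: ifP => _; ring.
Qed.

(** * Upper bound on the offline profit *)

Lemma history_beforeE (I : atp R) (w : 'I_(horizon I) -> price R)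
    (x : {ffun 'I_(horizon I) -> action}) t :
  history_before w x t = take t [seq (w u, x u) | u <- enum 'I_(horizon I)].
Proof.
rewrite /history_before -map_take; congr map.
apply: (inj_map val_inj); rewrite map_take val_enum_ord.
rewrite (@eq_filter _ _ (preim val (fun k => k < t)%N)) // -filter_map.
rewrite [map _ _]val_enum_ord.
have tn : (t <= horizon I)%N by apply: ltnW.
by rewrite take_iota (minn_idPl tn) (filter_iota_ltn 0).
Qed.

Lemma stock_after_rcons (I : atp R) (h : history R) pa :
  stock_after I (rcons h pa) = update_stock (stock_after I h) pa.2.
Proof. by rewrite /stock_after map_rcons -cats1 foldl_cat. Qed.

(** Potential argument: gain plus [lam] times the change of stock is the margin of the action, and
    the final stock has nonnegative value. *)
Lemma profit_le_margin (I : atp R) (w : 'I_(horizon I) -> price R)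
    (x : {ffun 'I_(horizon I) -> action}) lam g :
    0 <= lam ->
    (forall t a, (a = Buy -> (w t).1 != +oo%E) -> margin lam (w t) a <= g (w t)) ->
    feasible w x ->
  profit w x <= \sum_t g (w t) + lam * (init_stock I)%:R.
Proof.
move=> lam0 gmax /forallP feas.
pose h := [seq (w u, x u) | u <- enum 'I_(horizon I)].
have hsz : size h = horizon I by rewrite size_map size_enum_ord.
have step k : (k <= horizon I)%N ->
    \sum_(pa <- take k h) gain pa.1 pa.2
      + lam * (stock_after I (take k h))%:R
    <= \sum_(pa <- take k h) g pa.1 + lam * (init_stock I)%:R.
  elim: k => [_|k IH kn]; first by rewrite take0 !big_nil.
  have {IH} IH := IH (ltnW kn).
  pose t := Ordinal kn.
  have -> : take k.+1 h = rcons (take k h) (w t, x t).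
    rewrite (take_nth (w t, x t)) ?hsz // (nth_map t) ?size_enum_ord //.
    by rewrite (_ : nth _ _ _ = t) //; apply: val_inj; rewrite /= nth_enum_ord.
  rewrite !big_rcons /= stock_after_rcons /=.
  have := feas t; have := gmax t (x t); rewrite history_beforeE -/h /=.
  move: IH; case: (x t) => /= IH.
  - move=> gx /andP[_ poo]; have {gx poo} := gx (fun=> poo).
    by rewrite -natr1; lra.
  (* Feasibility makes the stock positive, so the truncated predecessor really drops by one. *)
  - move=> /(_ ltac:(done)) gx s0.
    by move: IH; rewrite -{1}(prednK s0) -natr1; lra.
  - by move=> /(_ ltac:(done)) gx _; lra.
have {step} := step _ (leqnn _); rewrite take_oversize ?hsz //.
rewrite /h !big_image /= -/(profit w x).
have : 0 <= lam * (stock_after I h)%:R by rewrite mulr_ge0.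
lra.
Qed.

Lemma offline_profit_le (I : atp R) (w : 'I_(horizon I) -> price R) lam g :
    0 <= lam ->
    (forall t a, (a = Buy -> (w t).1 != +oo%E) -> margin lam (w t) a <= g (w t)) ->
  offline_profit w <= \sum_t g (w t) + lam * (init_stock I)%:R.
Proof.
move=> lam0 gmax; apply: bigmax_le => [|x]; last exact: profit_le_margin.
(* The default value 0 of the maximum is covered because [Skip] has margin 0. *)
by rewrite addr_ge0 ?mulr_ge0 // sumr_ge0 // => t _; exact: (gmax t Skip).
Qed.

End Policy.

(** * Expectations over identically distributed requests as trajectory sums *)

Lemma run_sum_additive (R : comNzRingType) (Z : finType) (m : Z -> R) (g : Z -> R)
    (c : R) n h :
  \sum_z m z = 1 ->
  run_sum (fun _ => m) (fun h => \sum_(z <- h) g z + c) n h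
  = \sum_(z <- h) g z + n%:R * (\sum_z m z * g z) + c.
Proof.
move=> m1; elim: n h => [|n IH] h /=; first by rewrite mul0r addr0.
under eq_bigr => z _ do rewrite IH big_rcons /= -!addrA mulrDr [m z * (g z + _)]mulrDr.
by rewrite !big_split /= -!mulr_suml m1 !mul1r -natr1; ring.
Qed.

Section Unit.
Variables (R : realType) (n : nat) (D : price_dist R).
Variables (c1 : (1 <= 1)%N) (i1 : (1 <= 1)%N) (in1 : (1 <= n)%N) (cn : (1 <= 1 + n)%N).

Let I : atp R := ATP (fun _ : 'I_n => D) c1 i1 in1 cn.

Lemma price_expectation_iid (F : seq (price R) -> R) :
  price_expectation (I := I) (fun w => F [seq w t | t <- enum 'I_n])
  = run_sum (fun _ (z : finsupp D) => D (val z)) (fun h => F (map val h)) n [::].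
Proof.
rewrite -run_sum_ffun /price_expectation /=.
rewrite (reindex (fun f : {ffun 'I_n -> finsupp D} =>
  [ffun t => f t] : {dffun forall t : 'I_n, finsupp D})) /=; last first.
  exists (fun w : {dffun forall t : 'I_n, finsupp D} => [ffun t => w t]) => f _;
  by apply/ffunP => t; rewrite !ffunE.
apply: eq_bigr => f _; rewrite -map_comp; congr (_ * F _).
  by apply: eq_bigr => t _; rewrite ffunE.
by apply: eq_map => t; rewrite /= ffunE.
Qed.

Lemma expected_offline_le lam (g : price R -> R) : 0 <= lam ->
    (forall p a, p \in finsupp D -> (a = Buy -> p.1 != +oo%E) -> margin lam p a <= g p) ->
  expected_offline_profit I <= n%:R * mean D g + lam.
Proof.
move=> lam0 gmax; apply: (@le_trans _ _
  (price_expectation (I := I) (fun w => \sum_(p <- [seq w t | t <- enum 'I_n]) g p + lam))).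
  apply: ler_sum => w _; rewrite ler_wpM2l ?prodr_ge0 // => [t _|]; first exact: pmf_ge0.
  rewrite big_image /= -[lam]mulr1; apply: offline_profit_le => // t a.
  by apply: gmax; exact: fsvalP.
rewrite (price_expectation_iid (fun h => \sum_(p <- h) g p + lam)).
rewrite (eq_run_sum _ _ _ (F' := fun h => \sum_(z <- h) g (val z) + lam)) => [|h];
  last by rewrite big_map.
have m1 : \sum_(z : finsupp D) D (val z) = 1.
  by rewrite -(mean1 D); apply: eq_bigr => z _; rewrite mulr1.
have := run_sum_additive (fun z : finsupp D => g (val z)) lam n [::] m1.
by rewrite big_nil add0r => ->.
Qed.

Definition stepped (z : finsupp D * action) : price R * action := (val z.1, z.2).

(** Merging price and action into one symbol turns the double sum over prices and actions into one
    sum over words. *)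
Lemma expected_online_run (A : online_algorithm I) :
  expected_online_profit A
  = run_sum (fun h (z : finsupp D * action) =>
               D (val z.1) * A (map stepped h) (val z.1) z.2)
            (fun h => \sum_(z <- h) gain (val z.1) z.2) n [::].
Proof.
rewrite -run_sum_ffun /expected_online_profit /price_expectation /=.
under eq_bigr => w _ do rewrite mulr_sumr.
rewrite (pair_bigA _ (fun (w : {dffun forall t : 'I_n, finsupp D})
  (x : {ffun 'I_n -> action}) => (\prod_t D (val (w t))) *
  (action_probability A (fun t => val (w t)) x *
   profit (I := I) (fun t => val (w t)) x))) /=.
rewrite (reindex (fun f : {ffun 'I_n -> finsupp D * action} =>
  ([ffun t => (f t).1] : {dffun forall t : 'I_n, finsupp D},
   [ffun t => (f t).2] : {ffun 'I_n -> action}))) /=; last first.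
  exists (fun wx : {dffun forall t : 'I_n, finsupp D} * {ffun 'I_n -> action} =>
    [ffun t => (wx.1 t, wx.2 t)]) => [f|[w x]] _ /=.
    by apply/ffunP => t; rewrite !ffunE -surjective_pairing.
  by congr pair; apply/ffunP => t; rewrite !ffunE.
apply: eq_bigr => f _; rewrite mulrA; congr (_ * _); last first.
  by rewrite /profit big_image /=; apply: eq_bigr => t _; rewrite !ffunE.
rewrite /action_probability -big_split; apply: eq_bigr => t _ /=.
rewrite history_beforeE !ffunE map_take -map_comp; congr (_ * A (take _ _) _ _).
by apply: eq_map => u; rewrite /= !ffunE.
Qed.

(** * Expected profit of the threshold policy *)

Variables (lam th : R) (th01 : 0 <= th <= 1).

Let x := sell_prob lam th.
Let y := buy_prob lam th.

Definition policy_choice (h : history R) (p : price R) (a : action) : R :=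
  if (0 < stock_after I h)%N then
    match a with Sell => x p | Skip => 1 - x p | Buy => 0 end
  else match a with Buy => y p | Skip => 1 - y p | Sell => 0 end.

Lemma policy_choice_ge0 h p a : 0 <= policy_choice h p a.
Proof.
have [x0 y0 xy] := sell_buy_prob_bounds lam p th01.
by rewrite /policy_choice /x /y; case: ifP => _; case: a; lra.
Qed.

Lemma policy_choice_sum1 h p : \sum_a policy_choice h p a = 1.
Proof. by rewrite sum_action /policy_choice; case: ifP => _; ring. Qed.

Lemma policy_choice_allowed h p a : 0 < policy_choice h p a ->
  allowed (capacity I) (stock_after I h) p a.
Proof.
rewrite /policy_choice; case: posnP => [->|st]; case: a; rewrite /= ?st ?ltxx //=.
by rewrite /y /buy_prob; case: ifP; rewrite ?ltxx.
Qed.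

Definition threshold_policy : online_algorithm I :=
  OnlineAlgorithm policy_choice_ge0 policy_choice_sum1 policy_choice_allowed.

Let al := mean D x.
Let be := mean D y.
Let full_gain := mean D (fun p => x p * p.2).
Let empty_gain := - mean D (fun p => y p * fine p.1).

(* Expected profit of the policy over [m] more steps. *)
Fixpoint policy_value (m : nat) (full : bool) : R :=
  if m is m'.+1 then
    if full then full_gain + (1 - al) * policy_value m' true + al * policy_value m' false
    else empty_gain + be * policy_value m' true + (1 - be) * policy_value m' false
  else 0.

(** The policy sees the past only through the stock, which is 0 or 1, so the future value depends on
    one bit. *)
Lemma run_sum_policy m h : (stock_after I (map stepped h) <= 1)%N ->
  run_sum (fun h (z : finsupp D * action) =>
             D (val z.1) * threshold_policy (map stepped h) (val z.1) z.2)
          (fun h => \sum_(z <- h) gain (val z.1) z.2) m h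
  = \sum_(z <- h) gain (val z.1) z.2
    + policy_value m (0 < stock_after I (map stepped h))%N.
Proof.
elim: m h => [|m IH] h st1 /=; first by rewrite addr0.
rewrite sum_pair_action.
set G := \sum_(z <- h) _.
have IHr z a : (update_stock (stock_after I (map stepped h)) a <= 1)%N ->
    run_sum (fun h (z : finsupp D * action) =>
             D (val z.1) * threshold_policy (map stepped h) (val z.1) z.2)
          (fun h => \sum_(z <- h) gain (val z.1) z.2) m (rcons h (z, a))
    = G + gain (val z) a + policy_value m (0 < update_stock (stock_after I (map stepped h)) a)%N.
  by move=> st; rewrite IH map_rcons stock_after_rcons // big_rcons.
move: IHr st1; rewrite /policy_choice.
case: (stock_after _ _) => [|[|//]] IHr _ /=.
- transitivity (mean D (fun p => (G + policy_value m false) * 1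
      + ((-1) * (y p * fine p.1) + (policy_value m true - policy_value m false) * y p))).
    by apply: eq_bigr => z _; rewrite !IHr //=; ring.
  by rewrite !meanD !meanZ mean1 /empty_gain -/be; ring.
- transitivity (mean D (fun p => (G + policy_value m true) * 1
      + (x p * p.2 + (policy_value m false - policy_value m true) * x p))).
    by apply: eq_bigr => z _; rewrite (IHr _ Sell) // (IHr _ Skip) //= ltnn; ring.
  by rewrite !meanD !meanZ mean1 /full_gain -/al; ring.
Qed.

(** One step of the value recursion moves the mixture from the stock law at time [k] to that at
    [k + 1], emitting the expected gain at time [k]. *)
Lemma policy_value_mix m k :
  (1 - empty_prob al be k) * policy_value m true + empty_prob al be k * policy_value m false
  = \sum_(t < m) ((1 - empty_prob al be (k + t)) * full_gain
                  + empty_prob al be (k + t) * empty_gain).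
Proof.
elim: m k => [|m IH] k; first by rewrite big_ord0 /= !mulr0 addr0.
rewrite big_ord_recl addn0.
under eq_bigr => t _ do rewrite lift0 addnS -addSn.
by rewrite -IH /=; ring.
Qed.

Lemma expected_online_policy :
  expected_online_profit threshold_policy
  = (n%:R - \sum_(t < n) empty_prob al be t) * full_gain
    + (\sum_(t < n) empty_prob al be t) * empty_gain.
Proof.
rewrite expected_online_run run_sum_policy //= big_nil add0r.
have := policy_value_mix n 0; rewrite /= subr0 mul1r mul0r addr0 => ->.
rewrite big_split /= -!mulr_suml sumrB sumr_const card_ord.
by [].
Qed.

End Unit.

(** * Comparison of the online and offline bounds *)

Theorem theorem1p3 (R : realType) (I : atp R) (D : price_dist R)
    (iid : forall t : 'I_(horizon I), dist t = D)
    (B0_eq1 : init_stock I = 1%N) (B_eq1 : capacity I = 1%N) :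
  exists A : online_algorithm I,
    1 / 4 * expected_offline_profit I <= expected_online_profit A.
Proof.
case: I iid B0_eq1 B_eq1 => n B B0 dst c1 i1 n1 cn /= iid EB0 EB.
have {iid} dstE : dst = fun=> D by apply/boolp.funext.
subst B B0 dst.
have [lam [th [lam0 th01 alE]]] := balanced_policy D n1.
exists (threshold_policy D c1 i1 n1 cn lam th01); rewrite expected_online_policy.
pose x := sell_prob lam th; pose y := buy_prob lam th.
pose u p := x p * margin lam p Sell; pose v p := y p * margin lam p Buy.
have uv p : p \in finsupp D -> [/\ 0 <= u p, 0 <= v p
    & forall a, (a = Buy -> p.1 != +oo%E) -> margin lam p a <= u p + v p].
  by case/pmf_supp => p1 _; apply: margin_le_policy.
have offline : expected_offline_profit (ATP (fun=> D) c1 i1 n1 cn)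
    <= n%:R * (mean D u + mean D v) + lam.
  by rewrite -meanD; apply: expected_offline_le => // p a /uv[_ _]; exact.
have u0 : 0 <= mean D u by apply: mean_ge0 => p /uv[].
have v0 : 0 <= mean D v by apply: mean_ge0 => p /uv[].
rewrite -/x -/y in alE *.
have xy p := sell_buy_prob_bounds lam p th01.
have al0 : 0 <= mean D x by apply: mean_ge0 => p _; case: (xy p).
have be0 : 0 <= mean D y by apply: mean_ge0 => p _; case: (xy p).
have albe : mean D x + mean D y <= 1.
  by rewrite -meanD -(mean1 D); apply: mean_le => p _; case: (xy p).
(* Prices are split into margins and multiples of [lam]; the flow identity later collects the latter
   into [lam * r]. *)
have fullE : mean D (fun p => x p * p.2) = mean D u + lam * mean D x.
  by rewrite -meanZ -meanD; apply: eq_bigr => z _; rewrite /u /=; ring.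
have emptyE : mean D (fun p => y p * fine p.1) = lam * mean D y - mean D v.
  by rewrite -meanZ -sumrB; apply: eq_bigr => z _; rewrite /v /=; ring.
rewrite fullE emptyE.
have := empty_prob_flow (mean D x) (mean D y) n.
have := sum_empty_prob_ub al0 be0 albe n1 alE.
set r := empty_prob _ _ n; set Q := \sum_(t < n) _ => -[Qub r2] flow.
have Qu : n%:R / 2 * mean D u <= (n%:R - Q) * mean D u by rewrite ler_wpM2r //; lra.
have lamr : 2^-1 * lam <= r * lam by rewrite ler_wpM2r.
(* The purchase term alone limits the ratio to [1 / 4]; the other two terms keep a factor
   [1 / 2]. *)
have Qv : n%:R / 4 * mean D v <= Q * mean D v.
  move: (n1); rewrite leq_eqVlt => /predU1P[n1E|n2]; last first.
    by rewrite ler_wpM2r // sum_empty_prob_lb.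
  (* For [n = 1] the balance reads [al = be + 1], and [al + be <= 1] forces [be = 0]. *)
  have y_mean0 : mean D y = 0.
    by move: alE; rewrite -n1E invr1; lra.
  suff -> : mean D v = 0 by rewrite !mulr0.
  rewrite /mean big1 // => z _; rewrite /v mulrA.
  have /eqP := y_mean0; rewrite psumr_eq0 => [/allP/(_ z (mem_index_enum _))/eqP-> |z' _].
    by rewrite mul0r.
  by rewrite mulr_ge0 ?pmf_ge0 //; case: (xy (val z')).
have nu : 0 <= n%:R * mean D u by rewrite mulr_ge0.
have lamflow : lam * (mean D x * (n%:R - Q) - mean D y * Q) = r * lam.
  by rewrite flow mulrC.
lra.
Qed.
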